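(* Let $E$ and $F$ be Banach lattices and let $T:E\to F$ be a linear disjointness preserving operator. Then there is an order dense ideal $E_T$ of $E$ such that $T$ is norm bounded on $E_T$, i.e., there is a constant $C$ with $\|Tx\|\le C\|x\|$ for all $x\in E_T$.
   Context: Elements $x,y$ of a Banach lattice are disjoint, $x\perp y$, if $|x|\wedge|y|=0$. A linear operator $T:E\to F$ (not assumed continuous) is disjointness preserving if $x\perp y$ in $E$ implies $Tx\perp Ty$ in $F$. An ideal of $E$ is a (not necessarily closed) linear subspace $I$ such that $|y|\le|x|$, $x\in I$ implies $y\in I$; it is order dense if $I^d=\{y\in E:y\perp x\text{ for all }x\in I\}=\{0\}$. *)

(* Defs.v *)
From HB Require Import structures.
From mathcomp Require Import all_boot all_order all_algebra.
From mathcomp Require Import all_classical all_reals all_analysis.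

Set Implicit Arguments.
Unset Strict Implicit.
Unset Printing Implicit Defensive.

Import Order.TTheory GRing.Theory Num.Theory.
Import numFieldNormedType.Exports.

Local Open Scope classical_set_scope.
Local Open Scope ring_scope.

(* In ring_scope `|x| is the norm; the lattice modulus is [modulus] below.
   A plain record rather than an HB structure: an HB structure combining an
   order with a norm over a base field would lack a join with Num.NumDomain.
   The instances below put the normed-module structure and Order.Lattice on the
   carrier, and [bl_lerD2r], [bl_scaler_ge0], [bl_ler_norm] restate the axioms
   through them. The order is boolean-valued as everywhere in MathComp, which is
   no restriction under the classical axioms. The modulus is spelled out in [bl_norm_mono], the axiom
   |x| <= |y| -> ||x|| <= ||y||, because it precedes those instances. *)
Record banachLatticeType (R : realType) := BanachLattice {
  bl_space : completeNormedModType R;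
  bl_le : rel bl_space;
  bl_meet : bl_space -> bl_space -> bl_space;
  bl_join : bl_space -> bl_space -> bl_space;
  bl_le_refl : reflexive bl_le;
  bl_le_anti : antisymmetric bl_le;
  bl_le_trans : transitive bl_le;
  bl_lexI : forall x y z, bl_le x (bl_meet y z) = bl_le x y && bl_le x z;
  bl_leUx : forall x y z, bl_le (bl_join x y) z = bl_le x z && bl_le y z;
  bl_leD2r : forall z x y, bl_le x y -> bl_le (x + z) (y + z);
  bl_scale_ge0 : forall (a : R) x, 0 <= a -> bl_le 0 x -> bl_le 0 (a *: x);
  bl_norm_mono : forall x y,
    bl_le (bl_join x (- x)) (bl_join y (- y)) -> `|x| <= `|y|
}.

Definition bl_sort (R : realType) (E : banachLatticeType R) : Type :=
  bl_space E.
Coercion bl_sort : banachLatticeType >-> Sortclass.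

Section BanachLatticeInstances.
Context {R : realType} {E : banachLatticeType R}.

HB.instance Definition _ := CompleteNormedModule.copy (bl_sort E) (bl_space E).
HB.instance Definition _ := Order.Le_isPOrder.Build ring_display (bl_sort E)
  (@bl_le_refl R E) (@bl_le_anti R E) (@bl_le_trans R E).
HB.instance Definition _ :=
  Order.POrder_isMeetSemilattice.Build ring_display (bl_sort E) (@bl_lexI R E).
HB.instance Definition _ :=
  Order.POrder_isJoinSemilattice.Build ring_display (bl_sort E) (@bl_leUx R E).

End BanachLatticeInstances.

Section BanachLatticeDefs.
Context {R : realType} {E : banachLatticeType R}.

Lemma bl_lerD2r (z x y : E) : x <= y -> x + z <= y + z.
Proof. exact: bl_leD2r. Qed.

Lemma bl_scaler_ge0 (a : R) (x : E) : 0 <= a -> 0 <= x -> 0 <= a *: x.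
Proof. exact: bl_scale_ge0. Qed.

Definition modulus (x : E) : E := Order.join x (- x).

Lemma bl_ler_norm (x y : E) : modulus x <= modulus y -> `|x| <= `|y|.
Proof. exact: bl_norm_mono. Qed.

Definition disjoint_elts (x y : E) : Prop :=
  Order.meet (modulus x) (modulus y) = 0.

(* The ideal is not required to be norm closed. *)
Definition is_ideal (I : set E) : Prop :=
  [/\ I 0,
      (forall x y, I x -> I y -> I (x + y)),
      (forall (a : R) x, I x -> I (a *: x)) &
      (forall x y, I x -> modulus y <= modulus x -> I y)].

Definition disjoint_complement (I : set E) : set E :=
  [set y | forall x, I x -> disjoint_elts y x].

Definition order_dense (I : set E) : Prop :=
  disjoint_complement I = [set 0].

End BanachLatticeDefs.

Definition disjointness_preserving {R : realType}
    {E F : banachLatticeType R} (T : E -> F) : Prop :=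
  forall x y : E, disjoint_elts x y -> disjoint_elts (T x) (T y).

(* Main.v *)
(* E_T is the set of all x such that T is norm bounded on the positive part of
   the ideal generated by x. The gliding hump is that T cannot be large on a
   norm summable disjoint sequence (z_n): with b = sum z_n, |T z_n| <= |T b|.

   Density. Suppose that no nonzero element below some u > 0 lies in E_T. Then
   the ideal of u contains two disjoint nonzero positive elements v and w (else
   it is the line through u, on which T is bounded). Pick a small z in the ideal
   of v with T z large, and continue in the ideal of w.

   Boundedness. Suppose that T is unbounded on E_T. Pick a small x >= 0 in E_T
   with T x large, positive y_n in E_T with |y_n| <= 2^-n and T y_n large, and
   put b = sum y_n and z = (x - d b)^+ with d small. As T is bounded on the ideal
   of x, T z is close to T x, and the elements (y_n - x / d)^+, which are disjoint
   from z, still witness that T is unbounded; continue in the elements of E_T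
   disjoint from z. *)
Require Import Defs.
From mathcomp Require Import all_boot all_order all_algebra.
From mathcomp Require Import all_classical all_reals all_analysis.

Set Implicit Arguments.
Unset Strict Implicit.

Import Order.TTheory GRing.Theory Num.Theory.
Import numFieldNormedType.Exports.

Local Open Scope classical_set_scope.
Local Open Scope ring_scope.

(** * Order-theoretic calculus: modulus, meets, positive parts *)

Section RieszSpace.
Context {R : realType} {E : banachLatticeType R}.
Implicit Types (x y z t : E) (k : R).

Definition pospart x : E := Order.join x 0.

Lemma bl_subr_ge0 x y : (0 <= y - x) = (x <= y).
Proof.
apply/idP/idP => [/(bl_lerD2r x)|/(bl_lerD2r (- x))].
  by rewrite add0r subrK.
by rewrite subrr.
Qed.

Lemma bl_lerBlDr x y z : (x - y <= z) = (x <= z + y).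
Proof. by rewrite -[LHS]bl_subr_ge0 -[RHS]bl_subr_ge0 opprB addrA. Qed.

Lemma bl_lerD x y z t : x <= y -> z <= t -> x + z <= y + t.
Proof.
move=> xy zt; apply: (le_trans (bl_lerD2r z xy)).
by rewrite ![y + _]addrC; exact: bl_lerD2r.
Qed.

Lemma bl_ler_wDr x y : 0 <= y -> x <= x + y.
Proof. by move=> y0; rewrite -bl_subr_ge0 addrC addKr. Qed.

Lemma bl_oppr_le0 x : 0 <= x -> - x <= 0.
Proof. by move=> x0; rewrite -bl_subr_ge0 sub0r opprK. Qed.

Lemma bl_ler_wpZ2l k x y : 0 <= k -> x <= y -> k *: x <= k *: y.
Proof.
move=> k0 xy; rewrite -bl_subr_ge0 -scalerBr.
by apply: bl_scaler_ge0; rewrite ?bl_subr_ge0.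
Qed.

Lemma le_modulus x : x <= modulus x.
Proof. exact: leUl. Qed.

Lemma le_modulusN x : - x <= modulus x.
Proof. exact: leUr. Qed.

Lemma modulus_le x y : x <= y -> - x <= y -> modulus x <= y.
Proof. by move=> xy nxy; rewrite /modulus leUx xy. Qed.

Lemma modulus_ge0 x : 0 <= modulus x.
Proof.
have h : 0 <= modulus x + modulus x.
  rewrite -[0](subrr x); apply: bl_lerD; [exact: le_modulus|exact: le_modulusN].
have -> : modulus x = 2^-1 *: (modulus x + modulus x).
  by rewrite -[modulus x + _]mulr2n -[modulus x *+ 2]scaler_nat scalerA mulVf ?scale1r// pnatr_eq0.
by apply: bl_scaler_ge0 h; rewrite invr_ge0.
Qed.

Lemma modulus_id x : 0 <= x -> modulus x = x.
Proof. by move=> x0; apply: join_l; exact: le_trans (bl_oppr_le0 x0) x0. Qed.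

Lemma modulusN x : modulus (- x) = modulus x.
Proof. by rewrite /modulus opprK joinC. Qed.

Lemma ler_modulusD x y : modulus (x + y) <= modulus x + modulus y.
Proof.
by apply: modulus_le; rewrite ?opprD;
  apply: bl_lerD; rewrite ?le_modulus ?le_modulusN.
Qed.

Lemma ler_modulusZ k x : modulus (k *: x) <= `|k| *: modulus x.
Proof.
wlog k0 : k x / 0 <= k => [hw|].
  have [/hw//|k0] := leP 0 k.
  rewrite -[k]opprK scaleNr -scalerN normrN -[modulus x]modulusN.
  by apply: hw; rewrite oppr_ge0 ltW.
by rewrite (ger0_norm k0); apply: modulus_le; rewrite -?scalerN;
  apply: bl_ler_wpZ2l => //; rewrite ?le_modulus ?le_modulusN.
Qed.

Lemma bl_ler_norm_pos x y : 0 <= x -> x <= y -> `|x| <= `|y|.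
Proof.
by move=> x0 xy; apply: bl_ler_norm; rewrite !modulus_id// (le_trans x0 xy).
Qed.

Lemma norm_modulus x : `|modulus x| = `|x|.
Proof.
by apply/le_anti/andP; split; apply: bl_ler_norm;
  rewrite [modulus (modulus x)]modulus_id ?modulus_ge0.
Qed.

Lemma bl_le_meet x y z : x <= y -> x <= z -> x <= Order.meet y z.
Proof. by move=> xy xz; rewrite (lexI x y z) xy xz. Qed.

(** With [t] the left side, [t - z] lies below [x] and [y], hence below [Order.meet x y]; so
    [t - Order.meet x y] lies below [z], and it lies below [x] by positivity. *)
Lemma bl_meetD x y z : 0 <= x -> 0 <= y -> 0 <= z ->
  Order.meet x (y + z) <= Order.meet x y + Order.meet x z.
Proof.
move=> x0 y0 z0; rewrite [leRHS]addrC -bl_lerBlDr; apply: bl_le_meet.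
  rewrite bl_lerBlDr; apply: (le_trans (leIl _ _)).
  by apply: bl_ler_wDr; exact: bl_le_meet.
rewrite bl_lerBlDr [leRHS]addrC -bl_lerBlDr.
apply: bl_le_meet; rewrite bl_lerBlDr; last exact: leIr.
by apply: (le_trans (leIl _ _)); exact: bl_ler_wDr.
Qed.

Lemma meet_eq0_le x y z t : 0 <= x -> 0 <= z -> x <= y -> z <= t ->
  Order.meet y t = 0 -> Order.meet x z = 0.
Proof.
move=> x0 z0 xy zt yt; apply/le_anti/andP; split; last exact: bl_le_meet.
by rewrite -yt; exact: leI2.
Qed.

Lemma meet_eq0Z k x y : 0 <= k -> 0 <= x -> 0 <= y ->
  Order.meet x y = 0 -> Order.meet x (k *: y) = 0.
Proof.
move=> k0 x0 y0 xy.
have m0 : 0 < Num.max k 1 by rewrite lt_max ltr01 orbT.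
apply/le_anti/andP; split; last first.
  by apply: bl_le_meet => //; exact: bl_scaler_ge0.
(* Since [m] dominates both [1] and [k], the element [m^-1 *: t] lies below both [x] and [y]. *)
set t := Order.meet _ _; set m := Num.max k 1 in m0.
suff: m^-1 *: t <= 0.
  move=> /(bl_ler_wpZ2l (ltW m0)).
  by rewrite scaler0 scalerA mulfV ?scale1r// gt_eqF.
rewrite -xy; apply: bl_le_meet.
  apply: (@le_trans _ _ (m^-1 *: (m *: x))); last first.
    by rewrite scalerA mulVf ?scale1r// gt_eqF.
  apply: bl_ler_wpZ2l; first by rewrite invr_ge0 ltW.
  apply: (le_trans (leIl _ _)).
  rewrite -bl_subr_ge0 -{2}[x]scale1r -scalerBl bl_scaler_ge0//.
  by rewrite subr_ge0 /m le_max lexx orbT.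
apply: (@le_trans _ _ (m^-1 *: (m *: y))); last first.
  by rewrite scalerA mulVf ?scale1r// gt_eqF.
apply: bl_ler_wpZ2l; first by rewrite invr_ge0 ltW.
apply: (le_trans (leIr _ _)).
rewrite -bl_subr_ge0 -scalerBl bl_scaler_ge0//.
by rewrite subr_ge0 /m le_max lexx.
Qed.

Lemma pospart_ge0 x : 0 <= pospart x.
Proof. exact: leUr. Qed.

Lemma le_pospart x : x <= pospart x.
Proof. exact: leUl. Qed.

Lemma pospart_le x y : 0 <= y -> x <= y -> pospart x <= y.
Proof. by move=> y0 xy; rewrite /pospart leUx xy. Qed.

Lemma pospartB_le x y : 0 <= x -> 0 <= y -> pospart (x - y) <= x.
Proof. by move=> x0 y0; apply: pospart_le; rewrite // bl_lerBlDr bl_ler_wDr. Qed.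

(** The left side is in fact the meet of [x] and [y]: subtracting [pospart (x - y)] truncates [x] at
    [y], which serves below as Riesz decomposition. *)
Lemma pospartB_rest x y : x - pospart (x - y) <= y.
Proof. by rewrite bl_lerBlDr addrC -bl_lerBlDr le_pospart. Qed.

Lemma pospartZ k x : 0 <= k -> pospart (k *: x) <= k *: pospart x.
Proof.
move=> k0; apply: pospart_le; first by rewrite bl_scaler_ge0 ?pospart_ge0.
exact/bl_ler_wpZ2l/le_pospart.
Qed.

(** If [t] is the meet, then [t <= pospart (- x) <= pospart x - x], so [pospart x - t] is still a
    nonnegative upper bound of [x]; minimality of [pospart x] gives [t <= 0]. *)
Lemma pospart_disjoint x : Order.meet (pospart x) (pospart (- x)) = 0.
Proof.
apply/le_anti/andP; split; last by apply: bl_le_meet; exact: pospart_ge0.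
set t := Order.meet _ _.
suff: pospart x <= pospart x - t.
  by rewrite -bl_subr_ge0 addrC addKr -[- t]sub0r bl_subr_ge0.
apply: pospart_le; first by rewrite bl_subr_ge0 leIl.
rewrite -bl_subr_ge0 addrAC bl_subr_ge0; apply: (le_trans (leIr _ _)).
apply: pospart_le; first by rewrite bl_subr_ge0 le_pospart.
by rewrite -bl_subr_ge0 opprK subrK pospart_ge0.
Qed.

Lemma pospartBN x : pospart x - pospart (- x) = x.
Proof.
apply/le_anti/andP; split.
  rewrite bl_lerBlDr; apply: pospart_le; last first.
    by apply: bl_ler_wDr; exact: pospart_ge0.
  by rewrite addrC -bl_lerBlDr sub0r le_pospart.
rewrite -bl_subr_ge0 addrAC bl_subr_ge0.
apply: pospart_le; first by rewrite bl_subr_ge0 le_pospart.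
by rewrite -bl_subr_ge0 opprK subrK pospart_ge0.
Qed.

Lemma pospart_modulus x : pospart x <= modulus x.
Proof. exact/pospart_le/le_modulus/modulus_ge0. Qed.

Lemma disjoint_elts_pos x y : 0 <= x -> 0 <= y ->
  Order.meet x y = 0 -> disjoint_elts x y.
Proof. by move=> x0 y0 xy; rewrite /disjoint_elts !modulus_id. Qed.

(** In [modulus x <= modulus (x + y) + modulus y], meeting with [modulus x] kills the last term. *)
Lemma disjoint_norm_le x y : disjoint_elts x y -> `|x| <= `|x + y|.
Proof.
move=> xy; apply: bl_ler_norm.
have h : modulus x <= modulus (x + y) + modulus y.
  by rewrite -{1}(addrK y x) -[modulus y]modulusN; exact: ler_modulusD.
have {h} : modulus x <= Order.meet (modulus x) (modulus (x + y) + modulus y).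
  exact: bl_le_meet.
move=> /le_trans; apply.
apply: (le_trans (bl_meetD _ _ _)); rewrite ?modulus_ge0//.
by rewrite [X in _ + X]xy addr0 leIr.
Qed.

Lemma pospart_norm_le x : `|pospart x| <= `|x|.
Proof.
rewrite -[leRHS]norm_modulus.
exact/bl_ler_norm_pos/pospart_modulus/pospart_ge0.
Qed.

End RieszSpace.

(** * Summable series of positive elements and principal cones *)

Section BanachLattice.
Context {R : realType} {E : banachLatticeType R}.
Implicit Types (x y z u v w : E) (W : set E).

Lemma norm_small_eq0 x (K : R) :
  (forall d : R, 0 < d < 1 -> `|x| <= d * K) -> x = 0.
Proof.
move=> xK; apply/eqP; apply: contrapT => /negP; rewrite -normr_gt0 => x0.
have K0 : 0 < K.
  have /xK : 0 < (2^-1 : R) < 1 by rewrite invr_gt0 ltr0n invf_lt1 ?ltr1n.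
  by move=> /(lt_le_trans x0); rewrite pmulr_rgt0 ?invr_gt0.
have xK0 : 0 < `|x| + K by rewrite addr_gt0.
have /xK : 0 < `|x| / (`|x| + K) < 1.
  by rewrite divr_gt0//= ltr_pdivrMr// mul1r ltrDl.
by rewrite mulrAC ler_pdivlMr// ler_pM2l// leNgt ltrDr x0.
Qed.

(** Completeness gives the sum [b]. It dominates each partial sum because the positive part of that
    sum minus [b] is bounded in norm by arbitrarily late tails. *)
Lemma summable_nonneg (u : nat -> E) :
  (forall n, 0 <= u n) -> (forall n, `|u n| <= 2^-1 ^+ n) ->
  exists b, (forall n, \sum_(0 <= i < n) u i <= b) /\
    forall e : R, 0 < e ->
      exists N, forall n, (N <= n)%N -> `|b - \sum_(0 <= i < n) u i| <= e.
Proof.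
move=> u0 u2.
have /cvg_ex[b ub] : cvgn (series (u : nat -> bl_space E)).
  apply: normed_cvg; apply: (@series_le_cvg _ _ (geometric 1 2^-1)) => [n|n|n|].
  - exact: normr_ge0.
  - by rewrite /= mul1r exprn_ge0.
  - by rewrite /= mul1r; exact: u2.
  - by apply: is_cvg_geometric_series; rewrite ger0_norm// invf_lt1 ?ltr1n.
have bN (e : R) : 0 < e ->
    exists N, forall n, (N <= n)%N -> `|b - \sum_(0 <= i < n) u i| <= e.
  by move=> e0; have [N _ bN] := (cvgrPdist_le _ _).1 ub _ e0; exists N.
exists b; split=> // n.
have mono m : (n <= m)%N -> \sum_(0 <= i < n) u i <= \sum_(0 <= i < m) u i.
  elim: m => [|m IH]; first by rewrite leqn0 => /eqP ->.
  rewrite leq_eqVlt => /predU1P[-> //|/IH /le_trans]; apply.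
  by rewrite big_nat_recr//=; exact: bl_ler_wDr.
suff p0 : pospart (\sum_(0 <= i < n) u i - b) = 0.
  have := le_pospart (\sum_(0 <= i < n) u i - b).
  by rewrite p0 bl_lerBlDr add0r.
apply: (@norm_small_eq0 _ 1) => d /andP[/bN[N bd] _]; rewrite mulr1.
apply: (le_trans _ (bd (maxn n N) (leq_maxr _ _))).
rewrite -[leRHS]normrN opprB; apply: (le_trans _ (pospart_norm_le _)).
apply: bl_ler_norm_pos (pospart_ge0 _) _.
apply: pospart_le (pospart_ge0 _) _; apply: (le_trans _ (le_pospart _)).
by apply: bl_lerD2r; apply: mono; exact: leq_maxl.
Qed.

(** For [0 <= u], the positive part of the ideal generated by [u]. *)
Definition principal_cone u : set E :=
  [set v | 0 <= v /\ exists2 k : R, 0 <= k & v <= k *: u].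

Lemma principal_cone_le u v w :
  principal_cone u v -> 0 <= w -> w <= v -> principal_cone u w.
Proof.
by move=> [v0 [k k0 vu]] w0 wv; split=> //; exists k; rewrite ?(le_trans wv).
Qed.

Lemma principal_coneZ u v (k : R) :
  0 <= k -> principal_cone u v -> principal_cone u (k *: v).
Proof.
move=> k0 [v0 [l l0 vu]]; split; first exact: bl_scaler_ge0.
by exists (k * l); rewrite ?mulr_ge0// -scalerA; exact: bl_ler_wpZ2l.
Qed.

Lemma principal_cone_trans u v w :
  principal_cone u v -> principal_cone v w -> principal_cone u w.
Proof.
move=> uv [w0 [k k0 wv]].
exact: principal_cone_le (principal_coneZ k0 uv) w0 wv.
Qed.

Lemma principal_cone_id u : 0 <= u -> principal_cone u u.
Proof. by move=> u0; split=> //; exists 1; rewrite ?scale1r. Qed.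

Lemma principal_cone_disjoint u v x y : 0 <= u -> 0 <= v ->
  Order.meet u v = 0 -> principal_cone u x -> principal_cone v y ->
  Order.meet x y = 0.
Proof.
move=> u0 v0 uv [x0 [k k0 xu]] [y0 [l l0 yv]].
apply: (meet_eq0_le x0 y0 xu yv); apply: meet_eq0Z => //.
  exact: bl_scaler_ge0.
by rewrite meetC; apply: meet_eq0Z => //; rewrite meetC.
Qed.

(* If the cone of [u] has no two nonzero disjoint elements then it is totally
   ordered, because (y - z)^+ and (z - y)^+ are disjoint. *)
Lemma principal_cone_atom u : 0 <= u -> u <> 0 ->
  (forall v w, principal_cone u v -> principal_cone u w ->
    Order.meet v w = 0 -> v = 0 \/ w = 0) ->
  forall y, principal_cone u y -> y = (`|y| / `|u|) *: u.
Proof.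
move=> u0 /eqP; rewrite -normr_gt0 => nu0 atom.
have total y z : principal_cone u y -> principal_cone u z -> y <= z \/ z <= y.
  move=> uy uz.
  have /atom : principal_cone u (pospart (y - z)).
    by apply: (principal_cone_le uy (pospart_ge0 _));
       apply: pospartB_le; [case: uy|case: uz].
  have zy : principal_cone u (pospart (z - y)).
    by apply: (principal_cone_le uz (pospart_ge0 _));
       apply: pospartB_le; [case: uz|case: uy].
  move=> /(_ _ zy); rewrite -{1}(opprB y z) => /(_ (pospart_disjoint _)).
  case=> p0; [left|right].
    by have := le_pospart (y - z); rewrite p0 bl_lerBlDr add0r.
  by have := le_pospart (z - y); rewrite p0 bl_lerBlDr add0r.
move=> y uy; have [y0 _] := uy.
have [->|ny0] := eqVneq y 0; first by rewrite normr0 mul0r scale0r.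
rewrite -normr_gt0 in ny0.
set l := `|y| / `|u|.
have l0 : 0 < l by rewrite divr_gt0.
have nZ (k : R) : 0 <= k -> `|(k * l) *: u| = k * `|y|.
  move=> k0; rewrite normrZ ger0_norm ?mulr_ge0// ?ltW//.
  by rewrite /l -!mulrA mulVf ?gt_eqF// mulr1.
have cone (k : R) : 0 <= k -> principal_cone u ((k * l) *: u).
  move=> k0; apply: principal_coneZ; last exact: principal_cone_id.
  by rewrite mulr_ge0// ltW.
(* Here [l *: u] has the norm of [y]. By totality [y] is comparable with [((1 + d) * l) *: u] and
   [((1 - d) * l) *: u], and monotonicity of the norm excludes the wrong order; so [y - l *: u] has
   norm at most [d] times that of [y]. *)
apply/eqP; rewrite -subr_eq0; apply/eqP.
apply: (@norm_small_eq0 _ `|y|) => d /andP[d0 d1].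
rewrite -(nZ d) ?(ltW d0)//.
have up : y <= ((1 + d) * l) *: u.
  have d1' : 0 <= 1 + d by rewrite addr_ge0 ?ltW.
  have [//|yle] := total _ _ uy (cone _ d1').
  have [h _] := cone _ d1'.
  have := bl_ler_norm_pos h yle; rewrite nZ// mulrDl mul1r.
  by rewrite leNgt ltrDl mulr_gt0.
have low : ((1 - d) * l) *: u <= y.
  have d1' : 0 <= 1 - d by rewrite subr_ge0 ltW.
  have [yle|//] := total _ _ uy (cone _ d1').
  have := bl_ler_norm_pos y0 yle; rewrite nZ// mulrBl mul1r.
  by rewrite leNgt ltrBlDr ltrDl mulr_gt0.
apply: (@bl_ler_norm _ E (y - l *: u)).
rewrite [leRHS]modulus_id; last first.
  by case: (cone _ (ltW d0)).
apply: modulus_le.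
  by rewrite bl_lerBlDr -scalerDl addrC -{1}[l]mul1r -mulrDl.
rewrite opprB bl_lerBlDr addrC -bl_lerBlDr -scalerBl.
by rewrite -{1}[l]mul1r -mulrBl.
Qed.

End BanachLattice.

(** * The gliding hump *)

Section DisjointnessPreserving.
Context {R : realType} {E F : banachLatticeType R} (T : {linear E -> F}).
Context (hT : disjointness_preserving T).
Implicit Types (x y z u v w : E) (W : set E).

(* The sum [b] of the sequence splits as [z n] plus an element disjoint from
   [z n], so [|T (z n)| <= |T b|] for every [n]. *)
Lemma disjoint_sequence_bounded (z : nat -> E) :
  (forall n, 0 <= z n) -> (forall n, `|z n| <= 2^-1 ^+ n) ->
  (forall m n, (m < n)%N -> Order.meet (z m) (z n) = 0) ->
  exists M : R, forall n, `|T (z n)| <= M.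
Proof.
move=> z0 z2 zd.
have zd' m n : m != n -> Order.meet (z m) (z n) = 0.
  by rewrite neq_ltn => /orP[/zd//|/zd]; rewrite meetC.
have [b [Sb Slim]] := summable_nonneg z0 z2.
exists `|T b| => n.
pose r := b - z n.
have Sn m : (n < m)%N -> let s := \sum_(0 <= i < m) z i - z n in
    0 <= s /\ Order.meet (z n) s = 0.
  move=> nm; rewrite big_mkord (bigD1 (Ordinal nm))//= addrAC subrr add0r.
  elim/big_rec: _ => [|i s /= ni [s0 ds]].
    split=> //; apply/le_anti/andP; split; first exact: leIr.
    exact: bl_le_meet.
  have s0' : 0 <= z i + s by apply: (le_trans (z0 i)); exact: bl_ler_wDr.
  split=> //; apply/le_anti/andP; split; last exact: bl_le_meet.
  apply: (le_trans (bl_meetD (z0 n) (z0 i) s0)).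
  by rewrite ds addr0 zd'// eq_sym.
have r0 : 0 <= r.
  rewrite /r bl_subr_ge0; apply: (le_trans _ (Sb n.+1)).
  by rewrite -bl_subr_ge0; case: (Sn _ (ltnSn n)).
(* Disjointness passes to the limit: [r] is a partial remainder disjoint from [z n] plus a tail of
   norm at most [d], so the meet has norm at most [d]. *)
have zr : Order.meet (z n) r = 0.
  apply: (@norm_small_eq0 _ _ _ 1) => d /andP[/Slim[N Nd] _]; rewrite mulr1.
  have nN : (n < maxn n.+1 N)%N by exact: leq_maxl.
  apply: (le_trans _ (Nd _ (leq_maxr n.+1 N))).
  have [s0 sd] := Sn _ nN.
  have t0 : 0 <= b - \sum_(0 <= i < maxn n.+1 N) z i by rewrite bl_subr_ge0.
  apply: bl_ler_norm_pos; first exact: bl_le_meet.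
  have -> : r = (\sum_(0 <= i < maxn n.+1 N) z i - z n) +
                (b - \sum_(0 <= i < maxn n.+1 N) z i).
    by rewrite addrC addrA subrK.
  apply: (le_trans (bl_meetD (z0 n) s0 t0)).
  by rewrite sd add0r leIr.
have -> : b = z n + r by rewrite /r addrC subrK.
by rewrite linearD; apply/disjoint_norm_le/hT/disjoint_elts_pos.
Qed.

(** Common engine of density and boundedness. Iterating the step with [e = 2^-n] and [M = n] yields
    elements that are pairwise disjoint, since later ones come from the shrunken set, contradicting
    [disjoint_sequence_bounded]. *)
Lemma no_unbounded_splitting (Q : set (set E)) :
  (forall W, Q W -> forall x, W x -> 0 <= x) ->
  (forall W, Q W -> forall e M : R, 0 < e -> exists z W',
    [/\ W z /\ `|z| <= e, M <= `|T z|, W' `<=` W, Q W' &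
        forall w, W' w -> Order.meet z w = 0]) ->
  forall W, ~ Q W.
Proof.
move=> Qpos Qstep W0 QW0.
(* The state carries the stage number, so that the bounds at each stage are available to dependent
   choice. *)
pose X := {p : nat * set E | Q p.2}.
pose good (p q : X) z := [/\ (sval p).2 z, `|z| <= 2^-1 ^+ (sval p).1,
  (sval p).1%:R <= `|T z|, (sval q).2 `<=` (sval p).2 &
  forall w, (sval q).2 w -> Order.meet z w = 0].
have step (p : X) : {q : X | (sval q).1 = (sval p).1.+1 /\ exists z, good p q z}.
  apply: cid; case: p => -[n W] /= QW.
  have [|z [W' [[Wz ze] zM WW QW' zd]]] := Qstep _ QW (2^-1 ^+ n) n%:R.
    by rewrite exprn_gt0// invr_gt0.
  by exists (exist _ (n.+1, W') QW'); split=> //; exists z.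
have [f [f0 fS]] := dependent_choice step (exist _ (0%N, W0) QW0).
have fn n : (sval (f n)).1 = n.
  by elim: n => [|n IH]; [rewrite f0|rewrite (fS n).1 IH].
have [z zP] := choice (fun n => (fS n).2).
have Wmono m n : (m <= n)%N -> (sval (f n)).2 `<=` (sval (f m)).2.
  elim: n => [|n IH]; first by rewrite leqn0 => /eqP ->.
  rewrite leq_eqVlt => /predU1P[-> //|/IH h].
  by apply: (subset_trans _ h); case: (zP n).
have [|||M TM] := @disjoint_sequence_bounded z.
- by move=> n; apply: (Qpos _ (svalP (f n))); case: (zP n).
- by move=> n; case: (zP n) => _; rewrite fn.
- move=> m n mn; have [_ _ _ _ zd] := zP m; apply: zd.
  by apply: (Wmono _ _ mn); case: (zP n).
have M0 : 0 <= M by exact: le_trans (normr_ge0 _) (TM 0%N).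
have [_ _ + _ _] := zP (Num.Def.archi_bound M); rewrite fn.
by move=> /le_trans /(_ (TM _)); rewrite leNgt archi_boundP.
Qed.

(** * The ideal [E_T], with a bound that may still depend on the element *)

Definition regular : set E :=
  [set x | exists2 C : R, 0 <= C &
    forall y, principal_cone (modulus x) y -> `|T y| <= C * `|y|].

Lemma regular_solid x y : regular x -> modulus y <= modulus x -> regular y.
Proof.
move=> [C C0 Cx] yx; exists C => // z [z0 [k k0 zy]]; apply: Cx; split=> //.
by exists k => //; apply: (le_trans zy); exact: bl_ler_wpZ2l.
Qed.

Lemma regular_ideal : is_ideal regular.
Proof.
split; last exact: regular_solid.
- exists 0 => // y [y0 [k k0]]; rewrite modulus_id// scaler0 => yle.
  have -> : y = 0 by apply/le_anti/andP.
  by rewrite linear0 !normr0 mulr0.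
- move=> u v [C C0 Cu] [D D0 Dv]; exists (C + D); first exact: addr_ge0.
  move=> y [y0 [k k0 yk]].
  (* Riesz decomposition: [y - y2] lies below [k *: modulus u] and [y2] below [k *: modulus v]; both
     lie below [y], so their norms are controlled. *)
  pose y2 := pospart (y - k *: modulus u).
  have ku0 : 0 <= k *: modulus u by apply: bl_scaler_ge0 (modulus_ge0 _).
  have y2y : y2 <= y by exact: pospartB_le.
  have y20 : 0 <= y2 by exact: pospart_ge0.
  have y10 : 0 <= y - y2 by rewrite bl_subr_ge0.
  have y1y : y - y2 <= y by rewrite bl_lerBlDr bl_ler_wDr.
  have vy2 : principal_cone (modulus v) y2.
    split=> //; exists k => //; apply: pospart_le.
      exact: bl_scaler_ge0 (modulus_ge0 _).
    rewrite bl_lerBlDr -scalerDr addrC; apply: (le_trans yk).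
    by apply: bl_ler_wpZ2l => //; exact: ler_modulusD.
  have uy1 : principal_cone (modulus u) (y - y2).
    by split=> //; exists k => //; exact: pospartB_rest.
  rewrite -{1}(subrK y2 y) linearD mulrDl.
  apply: (le_trans (ler_normD _ _)); apply: lerD.
    by apply: (le_trans (Cu _ uy1)); rewrite ler_wpM2l// bl_ler_norm_pos.
  by apply: (le_trans (Dv _ vy2)); rewrite ler_wpM2l// bl_ler_norm_pos.
- move=> a x [C C0 Cx]; exists C => // y [y0 [k k0 yk]]; apply: Cx; split=> //.
  exists (k * `|a|); first by rewrite mulr_ge0.
  rewrite -scalerA; apply: (le_trans yk).
  by apply: bl_ler_wpZ2l => //; exact: ler_modulusZ.
Qed.

(** By homogeneity: an element on which [T] stretches by more than [|M| / e] is rescaled to norm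
    [e]. *)
Lemma unbounded_small W :
  (forall x (k : R), 0 <= k -> W x -> W (k *: x)) ->
  (forall C : R, 0 <= C -> exists2 x, W x & C * `|x| < `|T x|) ->
  forall e M : R, 0 < e -> exists x, [/\ W x, `|x| <= e & M <= `|T x|].
Proof.
move=> WZ Wunb e M e0.
have C0 : 0 <= `|M| / e by rewrite divr_ge0// ltW.
have [x Wx xC] := Wunb _ C0.
have nx0 : 0 < `|x|.
  rewrite normr_gt0; apply: contraTneq xC => ->.
  by rewrite linear0 !normr0 mulr0 ltxx.
have k0 : 0 <= e / `|x| by rewrite divr_ge0// ltW.
exists ((e / `|x|) *: x); split; first exact: WZ.
  by rewrite normrZ ger0_norm// divfK// gt_eqF.
rewrite linearZ normrZ (ger0_norm k0); apply: (le_trans (ler_norm M)).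
rewrite -ler_pdivrMl ?divr_gt0// invf_div mulrC mulrA.
by apply: le_trans (ltW xC); rewrite mulrAC.
Qed.

(** * Order density *)

Lemma regular_dense : order_dense regular.
Proof.
rewrite /order_dense; apply/seteqP; split=> [y yd|_ -> x _]; last first.
  rewrite /disjoint_elts modulus_id//; apply/le_anti/andP.
  split; first exact: leIl.
  by apply: bl_le_meet => //; exact: modulus_ge0.
suff : modulus y = 0.
  by move=> /= y0; apply/eqP; rewrite -normr_eq0 -norm_modulus y0 normr0.
apply: contrapT => ny0.
pose Q W := exists u, [/\ 0 <= u, u <> 0,
  (forall v, principal_cone u v -> regular v -> v = 0) & W = principal_cone u].
apply: (@no_unbounded_splitting Q _ _ (principal_cone (modulus y))).
- by move=> _ [u [_ _ _ ->]] x [].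
- move=> _ [u [u0 nu0 ureg ->]] e M e0.
  (* Otherwise [principal_cone_atom] makes the cone a half-line, on which [T] is bounded; then [u]
     is regular, hence zero. *)
  have [v [w [uv [uw [vw [nv0 nw0]]]]]] : exists v w, principal_cone u v /\
      principal_cone u w /\ Order.meet v w = 0 /\ v <> 0 /\ w <> 0.
    apply: contrapT => H; apply: (nu0); apply: ureg (principal_cone_id u0) _.
    exists (`|T u| / `|u|) => [|x]; first by rewrite divr_ge0.
    rewrite modulus_id// => ux.
    rewrite {1}(principal_cone_atom _ _ _ ux)//.
      by rewrite linearZ normrZ ger0_norm ?divr_ge0// [leLHS]mulrC mulrA mulrAC.
    move=> v w uv uw vw; apply: contrapT => /not_orP[nv nw]; apply: H.
    by exists v, w.
  have [v0 _] := uv; have [w0 _] := uw.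
  have [|C C0|z [vz ze zM]] := @unbounded_small (principal_cone v) _ _ e M e0.
  + by move=> x k k0; exact: principal_coneZ.
  + apply: contrapT => H; apply: nv0; apply: ureg uv _.
    exists C => // x; rewrite modulus_id// => vx.
    by rewrite leNgt; apply/negP => Cx; apply: H; exists x.
  exists z, (principal_cone w); split => //.
  + by split=> //; exact: principal_cone_trans vz.
  + by move=> x; exact: principal_cone_trans.
  + exists w; split=> // x wx; apply: ureg; exact: principal_cone_trans wx.
  + by move=> x; exact: principal_cone_disjoint vz.
(* A regular [v] in the cone of [modulus y] is disjoint from [modulus y], hence from itself. *)
- exists (modulus y); split=> //; first exact: modulus_ge0.
  move=> v yv vreg; have [v0 _] := yv.
  have yv0 : Order.meet (modulus y) v = 0.
    by rewrite -[in LHS](modulus_id v0); exact: yd.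
  have := principal_cone_disjoint (modulus_ge0 y) v0 yv0 yv (principal_cone_id v0).
  by rewrite meetxx.
Qed.

(** * Uniform boundedness *)

Lemma regular_bounded :
  exists C : R, forall x, regular x -> `|T x| <= C * `|x|.
Proof.
suff [C [C0 CT]] : exists C : R, 0 <= C /\
    forall x, regular x -> 0 <= x -> `|T x| <= C * `|x|.
  (* One [C] for each of the positive and negative parts of [x]. *)
  exists (C + C) => x xreg.
  rewrite -{1}(pospartBN x) linearB mulrDl.
  apply: (le_trans (ler_normB _ _)); apply: lerD.
    apply: (le_trans (CT _ _ (pospart_ge0 _))).
      apply: regular_solid xreg _.
      by rewrite modulus_id ?pospart_modulus// pospart_ge0.
    by rewrite ler_wpM2l// pospart_norm_le.
  apply: (le_trans (CT _ _ (pospart_ge0 _))).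
    apply: regular_solid xreg _; rewrite -[leRHS]modulusN.
    by rewrite modulus_id ?pospart_modulus// pospart_ge0.
  by rewrite ler_wpM2l// -[leRHS]normrN pospart_norm_le.
apply: contrapT => nC.
pose Q W := [/\ forall x, W x -> regular x /\ 0 <= x,
  forall x y, W x -> 0 <= y -> y <= x -> W y &
  forall e M : R, 0 < e -> exists x, [/\ W x, `|x| <= e & M <= `|T x|]].
apply: (@no_unbounded_splitting Q _ _ [set x | regular x /\ 0 <= x]).
- by move=> W [Wreg _ _] x /Wreg[].
- move=> W [Wreg Wdown Wunb] e M e0.
  (* The spare [1] pays for replacing [x] by [z]; likewise the spare [C] in the choice of [y] pays
     for cutting [y n] down to [w]. *)
  have [x [Wx xe xM]] := Wunb e (M + 1) e0.
  have [xreg x0] := Wreg _ Wx.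
  have [C C0 Cx] := xreg; rewrite (modulus_id x0) in Cx.
  have /choice[y yP] : forall n : nat, exists v,
      [/\ W v, `|v| <= 2^-1 ^+ n & n%:R + C <= `|T v|].
    by move=> n; apply: Wunb; rewrite exprn_gt0// invr_gt0.
  have y0 n : 0 <= y n by case: (yP n) => /Wreg[].
  have [b [Sb _]] := summable_nonneg y0 (fun n => let: And3 _ h _ := yP n in h).
  have yb n : y n <= b.
    apply: (le_trans _ (Sb n.+1)); rewrite big_nat_recr//= addrC.
    apply: bl_ler_wDr; elim/big_rec: _ => // i s _ s0.
    by apply: (le_trans (y0 i)); exact: bl_ler_wDr.
  have b0 : 0 <= b by exact: le_trans (y0 0%N) (yb 0%N).
  (* Chosen so that [C] times the norm of [d *: b] is at most [1]; as [x - z <= d *: b], this bounds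
     [T (x - z)]. *)
  pose d : R := (C * `|b| + 1)^-1.
  have K0 : 0 < C * `|b| + 1 by rewrite ltr_wpDl// mulr_ge0.
  have d0 : 0 < d by rewrite invr_gt0.
  have db0 : 0 <= d *: b by exact: bl_scaler_ge0 (ltW d0) b0.
  pose z := pospart (x - d *: b).
  have z0 : 0 <= z by exact: pospart_ge0.
  have zx : z <= x by exact: pospartB_le.
  exists z, [set w | W w /\ Order.meet z w = 0]; split.
  + split; first exact: Wdown zx.
    by apply: le_trans xe; exact: bl_ler_norm_pos.
  + have : `|T (x - z)| <= 1.
      have xz0 : 0 <= x - z by rewrite bl_subr_ge0.
      have xzx : x - z <= x by rewrite bl_lerBlDr bl_ler_wDr.
      apply: (le_trans (Cx _ (principal_cone_le (principal_cone_id x0) xz0 xzx))).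
      apply: (@le_trans _ _ (C * `|d *: b|)).
        by rewrite ler_wpM2l// bl_ler_norm_pos// pospartB_rest.
      rewrite normrZ (gtr0_norm d0) mulrCA mulrC /d.
      by rewrite ler_pdivrMr// mul1r lerDl.
    rewrite linearB => h.
    rewrite -(lerD2r 1); apply: (le_trans xM).
    rewrite -[T x](subrK (T z)) addrC; apply: (le_trans (ler_normD _ _)).
    by rewrite lerD2l.
  + by move=> w [].
  + split=> [w [/Wreg]//|w v [Ww zw] v0 vw|e' M' e'0].
      split; first exact: Wdown Ww v0 vw.
      have [_ w0] := Wreg _ Ww.
      exact: (meet_eq0_le z0 v0 (lexx z) vw zw).
    (* Large enough for [M' <= n] and, through [n < 2 ^ n], for [2^-n <= e']. *)
    pose n := maxn (Num.Def.archi_bound `|M'|) (Num.Def.archi_bound e'^-1).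
    have [Wy yn yT] := yP n.
    have dx0 : 0 <= d^-1 *: x by apply: bl_scaler_ge0 x0; rewrite invr_ge0 ltW.
    pose w := pospart (y n - d^-1 *: x).
    have w0 : 0 <= w by exact: pospart_ge0.
    have wy : w <= y n by exact: pospartB_le.
    exists w; split.
    * split; first exact: Wdown wy.
      (* As [y n <= b], [z] lies below the first positive part, while [w] lies below [d^-1] times
         the second. *)
      have h : Order.meet (pospart (x - d *: y n)) (pospart (d *: y n - x)) = 0.
        by rewrite -[d *: y n - x]opprB; exact: pospart_disjoint.
      have dV : 0 <= d^-1 by rewrite invr_ge0 ltW.
      apply: (meet_eq0_le z0 w0 _ _
        (meet_eq0Z dV (pospart_ge0 _) (pospart_ge0 _) h)).
        apply: pospart_le (pospart_ge0 _) _.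
        apply: (le_trans _ (le_pospart _)).
        rewrite -bl_subr_ge0 opprB addrC addrA subrK -scalerBr.
        by apply: bl_scaler_ge0 (ltW d0) _; rewrite bl_subr_ge0.
      apply: (le_trans _ (pospartZ _ dV)).
      by rewrite scalerBr scalerA mulVf ?scale1r// gt_eqF.
    * apply: (le_trans (bl_ler_norm_pos w0 wy)); apply: (le_trans yn).
      rewrite exprVn -[leRHS]invrK lef_pV2 ?posrE ?exprn_gt0 ?invr_gt0//.
      have e'V : 0 <= e'^-1 by rewrite invr_ge0 ltW.
      apply: (le_trans (ltW (archi_boundP e'V))).
      rewrite -natrX ler_nat.
      exact: (leq_trans (leq_maxr _ _) (ltnW (ltn_expl n _))).
    (* The removed part [y n - w] lies below [d^-1 *: x] and has norm at most [1], so regularity of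
       [x] bounds its image by [C], whatever the size of [d^-1]. *)
    * have yw0 : 0 <= y n - w by rewrite bl_subr_ge0.
      have cw : principal_cone x (y n - w).
        split=> //; exists d^-1; first by rewrite invr_ge0 ltW.
        exact: pospartB_rest.
      have ywy : `|y n - w| <= 1.
        apply: (@le_trans _ _ `|y n|).
          by apply: bl_ler_norm_pos yw0 _; rewrite bl_lerBlDr bl_ler_wDr.
        by apply: (le_trans yn); rewrite exprn_ile1// invf_le1// ler1n.
      have h : `|T (y n - w)| <= C.
        by apply: (le_trans (Cx _ cw)); rewrite ler_piMr.
      rewrite -(lerD2r C).
      apply: (@le_trans _ _ `|T (y n)|).
        apply: (le_trans _ yT); rewrite lerD2r; apply: (le_trans (ler_norm _)).
        apply: (le_trans (ltW (archi_boundP (normr_ge0 _)))).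
        by rewrite ler_nat leq_maxl.
      rewrite -{1}(subrK w (y n)) linearD [leRHS]addrC.
      by apply: (le_trans (ler_normD _ _)); rewrite lerD2r.
  + by move=> w [].
- split=> [//|x y [xreg x0] y0 yx|e M e0].
    by split=> //; apply: regular_solid xreg _; rewrite !modulus_id.
  apply: unbounded_small => // [x k k0 [xreg x0]|C C0].
    split; last exact: bl_scaler_ge0.
    by have [_ _ regZ _] := regular_ideal; exact: regZ.
  apply: contrapT => H; apply: nC; exists C; split=> // x xreg x0.
  by rewrite leNgt; apply/negP => Cx; apply: H; exists x.
Qed.

End DisjointnessPreserving.

Unset Implicit Arguments.
Set Strict Implicit.

Theorem theorem3p3 (R : realType) (E F : banachLatticeType R)
    (T : {linear E -> F}) (hT : disjointness_preserving T) :
  exists E_T : set E,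
    [/\ is_ideal E_T,
        order_dense E_T &
        exists C : R, forall x : E, E_T x -> `|T x| <= C * `|x|].
Proof.
exists (regular T); split.
- exact: regular_ideal.
- exact: regular_dense hT.
- exact: regular_bounded hT.
Qed.
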